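(* Let $G$ be a finite commutative group. Let $m=p_1^{r_1}p_2^{r_2}\cdots p_j^{r_j}$ be the prime factorization of the integer $m\geq 2$. Set $k=\max\{r_1,r_2,\ldots,r_j\}$, $c_i=(p_1p_2\cdots p_j)/p_i$, and let $t_i$ be a natural number such that $t_ic_i\equiv 1\pmod{p_i}$ for $i=1,2,\dots,j$. If $\bar f_i$ is an invertible element of the group ring $\mathbb{Z}_{p_i}G$ for $i=1,2,\dots,j$, then \[f=t_1c_1f_1+t_2c_2f_2+\cdots+t_jc_jf_j\] is an invertible element of the group ring $\mathbb{Z}_mG$, with \[f^{-1}=(t_1c_1g_1+t_2c_2g_2+\cdots+t_jc_jg_j)^{(p_1p_2\cdots p_j)^{k-1}}(t_1c_1f_1+t_2c_2f_2+\cdots+t_jc_jf_j)^{(p_1p_2\cdots p_j)^{k-1}-1},\] where $\bar g_i\in\mathbb{Z}_{p_i}G$ is such that $\bar f_i\bar g_i=\bar 1$. Moreover, \[|(\mathbb{Z}_mG)^{\ast}|=\left(\frac{m}{p_1p_2\cdots p_j}\right)^{|G|}|(\mathbb{Z}_{p_1p_2\cdots p_j}G)^{\ast}|.\]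
   Context: $\mathbb{Z}_m$ is the ring of integers modulo $m$, $AG$ denotes the group ring of $G$ over $A$, and $A^{\ast}$ denotes the group of invertible elements of a ring $A$. The primes $p_1,\dots,p_j$ are distinct and $r_i\ge 1$. Here $f_i,g_i$ are elements of the integral group ring $\mathbb{Z}G$ (arbitrary representatives of their classes), $\bar f_i,\bar g_i$ are their images in $\mathbb{Z}_{p_i}G$ under reduction of coefficients modulo $p_i$, and the displayed formulas for $f$ and $f^{-1}$ are read in $\mathbb{Z}_mG$ by reducing coefficients modulo $m$. *)

(* Defs.v *)
From HB Require Import structures.
From mathcomp Require Import all_boot all_order all_algebra all_fingroup.

Set Implicit Arguments.
Unset Strict Implicit.
Unset Printing Implicit Defensive.

Import GRing.Theory.
Local Open Scope ring_scope.

(* The group ring RG of the finite group gT: the function f stands for the     *)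
(* formal sum \sum_g f(g) g.  The alias is essential, as {ffun gT -> R} itself *)
(* carries the pointwise product, whereas group_ring carries convolution.      *)
Definition group_ring (R : Type) (gT : finGroupType) : Type := {ffun gT -> R}.

HB.instance Definition _ (R : nzRingType) (gT : finGroupType) :=
  GRing.Zmodule.copy (group_ring R gT) {ffun gT -> R}.

HB.instance Definition _ (R : finNzRingType) (gT : finGroupType) :=
  Finite.copy (group_ring R gT) {ffun gT -> R}.

Section GroupRing.

Variables (R : nzRingType) (gT : finGroupType).
Implicit Types f g h : group_ring R gT.

Definition gring_one : group_ring R gT := [ffun x : gT => (x == 1%g)%:R].

Definition gring_mul f g : group_ring R gT :=
  [ffun x : gT => \sum_(y : gT) f y * g (y^-1 * x)%g].

Fact gring_mulA : associative gring_mul.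
Proof.
move=> f g h; apply/ffunP=> x; rewrite !ffunE.
under eq_bigr => y _ do rewrite ffunE mulr_sumr.
under [RHS]eq_bigr => y _ do rewrite ffunE mulr_suml.
rewrite [RHS]exchange_big /=; apply: eq_bigr => y _.
rewrite [RHS](reindex_inj (mulgI y)) /=; apply: eq_bigr => z _.
by rewrite mulKg invMg mulgA mulrA.
Qed.

Fact gring_mul1r : left_id gring_one gring_mul.
Proof.
move=> f; apply/ffunP=> x; rewrite ffunE (bigD1 1%g) //= big1 => [|y /negPf ny].
  by rewrite ffunE eqxx mul1r invg1 mul1g addr0.
by rewrite ffunE ny mul0r.
Qed.

Fact gring_mulr1 : right_id gring_one gring_mul.
Proof.
move=> f; apply/ffunP=> x; rewrite ffunE (bigD1 x) //= big1 => [|y /negPf ny].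
  by rewrite ffunE mulVg eqxx mulr1 addr0.
by rewrite ffunE -eq_mulVg1 ny mulr0.
Qed.

Fact gring_mulDl : left_distributive gring_mul +%R.
Proof.
move=> f g h; apply/ffunP=> x; rewrite !ffunE -big_split /=.
by apply: eq_bigr => y _; rewrite ffunE mulrDl.
Qed.

Fact gring_mulDr : right_distributive gring_mul +%R.
Proof.
move=> f g h; apply/ffunP=> x; rewrite !ffunE -big_split /=.
by apply: eq_bigr => y _; rewrite ffunE mulrDr.
Qed.

Fact gring_oner_neq0 : gring_one != 0.
Proof.
apply/eqP=> /ffunP/(_ 1%g)/eqP.
by rewrite !ffunE eqxx oner_eq0.
Qed.

HB.instance Definition _ :=
  GRing.Zmodule_isNzRing.Build (group_ring R gT) gring_mulA gring_mul1r
    gring_mulr1 gring_mulDl gring_mulDr gring_oner_neq0.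

End GroupRing.

(* Over a finite ring the group ring is finite; the factory makes its units    *)
(* the two-sided invertible elements, with GRing.inv their inverse.            *)
HB.instance Definition _ (R : finNzRingType) (gT : finGroupType) :=
  FinRing.isNzRing.Build (group_ring R gT).

(* Reduction of the coefficients along the canonical morphism from int to R,   *)
(* i.e., modulo n when R is 'Z_n with 1 < n.                                   *)
Definition gring_red (R : nzRingType) (gT : finGroupType)
    (f : group_ring int gT) : group_ring R gT :=
  [ffun x : gT => (f x)%:~R].
Arguments gring_red R {gT} f.

(* Main.v *)
Require Import Defs.
From HB Require Import structures.
From mathcomp Require Import all_boot all_order all_algebra all_fingroup.
From mathcomp Require Import zify.

Set Implicit Arguments.
Unset Strict Implicit.
Unset Printing Implicit Defensive.

Import GRing.Theory.
Local Open Scope ring_scope.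

(** Everything is computed in the integral group ring, where reduction modulo
    n is a ring morphism whose kernel consists of the multiples of n.

    Let P be the product of the primes p_i.  Modulo p_i the coefficient
    t_i c_i is 1 and every other t_l c_l is 0, so the combination F of the f_i
    reduces to f_i and the combination G of the g_i reduces to g_i.  Hence
    F G - 1 is divisible by every p_i, so by P: F G = 1 + P h.  In any ring, if
    a is congruent to 1 modulo N and n divides N, then a ^ n is congruent to 1
    modulo N n, because the binomial expansion of (1 + u) ^ n is 1 + n u modulo
    u ^ 2.  Iterating from N = n = P, (F G) ^ (P ^ (k - 1)) is congruent to 1
    modulo P ^ k, which m divides ([gring_red_eq1_exp]).  The group ring being
    commutative, this gives F * (G ^ q * F ^ (q - 1)) = 1 with q = P ^ (k - 1).

    The same power argument, applied to a lift of the inverse, shows that an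
    element is a unit modulo m exactly when it is a unit modulo P
    ([gring_red_unitE]).  The units of Z_m G are thus the preimage of those of
    Z_P G under the additive surjection Z_m G -> Z_P G, all of whose fibres
    have the same cardinal ([card_preim_additive]); comparing with
    |Z_m G| = m ^ |G| and |Z_P G| = P ^ |G| gives the count. *)

(** * Powers of elements congruent to 1 *)

Lemma expr1D_square (R : nzRingType) (u : R) n :
  exists v, (1 + u) ^+ n = 1 + u *+ n + u ^+ 2 * v.
Proof.
elim: n => [|n [v IHn]]; first by exists 0; rewrite mulr0 !addr0.
exists (v + 1 *+ n + v * u); rewrite exprSr IHn.
rewrite !mulrDr !mulr1 mulrnAr mulr1 mulrA !mulrDl mul1r mulrnAl -expr2 mulrSr.
rewrite -!addrA; congr (1 + (_ + _)).
by rewrite addrCA; congr (_ + _); rewrite addrCA.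
Qed.

(** With u = N b, the linear term n u of the expansion is a multiple of N n,
    and so is u ^ 2, since it is a multiple of N ^ 2 and n divides N. *)
Lemma exp_1DmulrnM (R : nzRingType) n N (a b : R) : (n %| N)%N ->
  a = 1 + b *+ N -> exists c, a ^+ n = 1 + c *+ (N * n).
Proof.
move=> /dvdnP[q ->] ->; have [v ->] := expr1D_square (b *+ (q * n)) n.
exists (b + b * b * v *+ q).
rewrite mulrnDl -addrA -mulrnA; congr (_ + (_ + _)).
by rewrite expr2 mulrnAl mulrnAr mulrnAl mulrnAl -!mulrnA; congr (_ *+ _); lia.
Qed.

Lemma exp_1Dmulrn (R : nzRingType) n e (a b : R) :
  a = 1 + b *+ n -> exists c, a ^+ (n ^ e) = 1 + c *+ (n ^ e.+1).
Proof.
move=> a_eq; elim: e => [|e [c IHe]]; first by exists b; rewrite expr1.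
rewrite expnSr exprM expnSr; apply: exp_1DmulrnM IHe.
by rewrite expnS dvdn_mulr.
Qed.

(** * Divisibility by a product of distinct primes *)

Lemma dvdn_prod_primes j (p : 'I_j -> nat) a :
  (forall i, prime (p i)) -> injective p -> (forall i, p i %| a)%N ->
  (\prod_(i < j) p i %| a)%N.
Proof.
move=> p_prime p_inj pa; have := index_enum_uniq 'I_j.
elim: (index_enum _) => [|i s IHs] /=; first by rewrite big_nil.
case/andP=> i_s s_uniq; rewrite big_cons Gauss_dvd ?pa ?IHs //.
rewrite big_seq; apply: (big_ind (coprime (p i))) => [|x y px py|l ls].
- exact: coprimen1.
- by rewrite coprimeMr px.
- rewrite prime_coprime // dvdn_prime2 //; apply: contra i_s => /eqP/p_inj->.
  exact: ls.
Qed.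

(** * Preimages under additive surjections *)

(** Translation identifies every fibre with the kernel.  With K the cardinal of
    the kernel, the preimage of V has #|V| * K elements; taking V to be all of
    B gives #|A| = #|B| * K, and K is eliminated between the two. *)
Lemma card_preim_additive (A B : finZmodType) (phi : A -> B) (V : {pred B}) :
  {morph phi : x y / x + y} -> (forall y, exists x, phi x = y) ->
  (#|[pred x | phi x \in V]| * #|B| = #|V| * #|A|)%N.
Proof.
move=> phiD phi_surj.
pose K := #|[pred x | phi x == 0]|.
have fibre y : #|[pred x | phi x == y]| = K.
  have [x0 <-] := phi_surj y.
  rewrite -[RHS](card_image (addrI x0)); apply: eq_card => x; rewrite [LHS]inE.
  apply/eqP/imageP=> [x_x0|[z /eqP z0 ->]]; last by rewrite phiD z0 addr0.
  exists (x - x0); last by rewrite addrC subrK.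
  by apply/eqP/(addIr (phi x0)); rewrite -phiD subrK add0r.
have count (W : {pred B}) : #|[pred x | phi x \in W]| = (#|W| * K)%N.
  rewrite -sum1_card (partition_big phi (mem W)) //= -sum_nat_const.
  apply: eq_bigr => y Wy; rewrite -(fibre y) -sum1_card.
  apply: eq_bigl => x; rewrite !inE; case: eqP => [->|]; last by rewrite andbF.
  by rewrite Wy.
rewrite count mulnAC -[LHS]mulnA; congr muln.
by rewrite -(count predT); apply: eq_card.
Qed.

(** * Reduction of integral group rings *)

Section Reduction.

Variable gT : finGroupType.

Lemma gring_red_zmod_morphism (R : nzRingType) :
  zmod_morphism (@gring_red R gT).
Proof. by move=> f g; apply/ffunP=> x; rewrite !ffunE intrB. Qed.

Lemma gring_red_monoid_morphism (R : nzRingType) :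
  monoid_morphism (@gring_red R gT).
Proof.
split=> [|f g]; apply/ffunP=> x; rewrite !ffunE; first by case: eqP.
by rewrite rmorph_sum; apply: eq_bigr => y _; rewrite !ffunE rmorphM.
Qed.

HB.instance Definition _ (R : nzRingType) :=
  GRing.isZmodMorphism.Build _ _ (@gring_red R gT)
    (@gring_red_zmod_morphism R).
HB.instance Definition _ (R : nzRingType) :=
  GRing.isMonoidMorphism.Build _ _ (@gring_red R gT)
    (@gring_red_monoid_morphism R).

Lemma intr_Zp_eq0 n (z : int) :
  (1 < n)%N -> (z%:~R == 0 :> 'Z_n) = (n %| `|z|)%N.
Proof.
move=> n_gt1.
have natE k : (k%:R == 0 :> 'Z_n) = (n %| k)%N.
  by rewrite -val_eqE /= val_Zp_nat.
by case: (intP z) => [|k|k]; rewrite ?mulrNz ?oppr_eq0 ?abszN -?pmulrn natE.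
Qed.

Lemma gring_red_eq0P n (a : group_ring int gT) : (1 < n)%N ->
  reflect (forall x, (n %| `|a x|)%N) (gring_red 'Z_n a == 0).
Proof.
move=> n_gt1; apply: (iffP eqP) => [/ffunP a0 x|a0].
  by have:= a0 x; rewrite !ffunE => /eqP; rewrite intr_Zp_eq0.
by apply/ffunP=> x; rewrite !ffunE; apply/eqP; rewrite intr_Zp_eq0.
Qed.

Lemma gring_red_eq0_mulrn n (a : group_ring int gT) : (1 < n)%N ->
  gring_red 'Z_n a = 0 -> exists b, a = b *+ n.
Proof.
move=> n_gt1 /eqP/(gring_red_eq0P _ n_gt1) a0.
exists [ffun x => (a x %/ n)%Z]; apply/ffunP=> x.
by rewrite ffunMnE ffunE -mulr_natr natz divzK // dvdzE.
Qed.

Lemma gring_red_mulrn n N (a : group_ring int gT) : (1 < n)%N -> (n %| N)%N ->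
  gring_red 'Z_n (a *+ N) = 0.
Proof.
move=> n_gt1 nN; apply/eqP/gring_red_eq0P => // x.
by rewrite ffunMnE -mulr_natr natz abszM dvdn_mull.
Qed.

Lemma gring_red_eq1_exp n N e (a : group_ring int gT) :
  (1 < n)%N -> (1 < N)%N -> (N %| n ^ e.+1)%N ->
  gring_red 'Z_n a = 1 -> gring_red 'Z_N a ^+ (n ^ e) = 1.
Proof.
move=> n_gt1 N_gt1 Nn a1.
have [b a_eq] : exists b, a - 1 = b *+ n.
  by apply: gring_red_eq0_mulrn => //; rewrite rmorphB /= a1 rmorph1 subrr.
have [c ca] : exists c, a ^+ (n ^ e) = 1 + c *+ (n ^ e.+1).
  by apply: (@exp_1Dmulrn _ _ _ _ b); rewrite -a_eq addrC subrK.
by rewrite -rmorphXn ca rmorphD rmorph1 /= gring_red_mulrn // addr0.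
Qed.

Definition gring_lift n (y : group_ring 'Z_n gT) : group_ring int gT :=
  [ffun x => Posz (y x)].

Lemma gring_liftK n : cancel (@gring_lift n) (gring_red 'Z_n).
Proof. by move=> y; apply/ffunP=> x; rewrite !ffunE -pmulrn natr_Zp. Qed.

(** Makes [gring_red 'Z_n \o @gring_lift N] the canonical map from the group
    ring modulo N to the group ring modulo n, for n dividing N. *)
Lemma gring_red_lift_red n N (a : group_ring int gT) :
  (1 < n)%N -> (1 < N)%N -> (n %| N)%N ->
  gring_red 'Z_n (gring_lift (gring_red 'Z_N a)) = gring_red 'Z_n a.
Proof.
move=> n_gt1 N_gt1 nN; apply/eqP; rewrite -subr_eq0 -rmorphB.
have [|b /= ->] :=
    @gring_red_eq0_mulrn _ (gring_lift (gring_red 'Z_N a) - a) N_gt1.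
  by rewrite rmorphB /= gring_liftK subrr.
by rewrite gring_red_mulrn.
Qed.

End Reduction.

(** * Units of commutative group rings *)

Section Units.

Variables (gT : finGroupType) (abG : abelian [set: gT]).

Lemma gring_mulC (R : comNzRingType) :
  commutative (@GRing.mul (group_ring R gT)).
Proof.
move=> f g; apply/ffunP=> x; rewrite !ffunE.
rewrite (reindex_inj (inj_comp (mulgI x) invg_inj)) /=.
apply: eq_bigr => y _; rewrite mulrC; congr (g _ * f _).
  by rewrite invMg invgK mulgKV.
by rewrite (centsP abG) ?inE.
Qed.

Lemma gring_mul_eq1 (R : finComNzRingType) (x y : group_ring R gT) :
  x * y = 1 -> x \is a GRing.unit /\ x^-1 = y.
Proof.
move=> xy1; have yx1 : y * x = 1 by rewrite gring_mulC.
have x_unit : x \is a GRing.unit by apply/unitrP; exists y.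
by split=> //; apply: (mulrI x_unit); rewrite mulrV.
Qed.

Lemma gring_exp_eq1 (R : finComNzRingType) (x y : group_ring R gT) q :
  (0 < q)%N -> (x * y) ^+ q = 1 ->
  x \is a GRing.unit /\ x^-1 = y ^+ q * x ^+ (q - 1).
Proof.
case: q => // q _; rewrite subn1 /= exprMn_comm; last exact: gring_mulC.
by rewrite exprS -mulrA [x ^+ q * _]gring_mulC //; apply: gring_mul_eq1.
Qed.

(** Units lift because n is nilpotent modulo N: if a b is 1 modulo n, then a
    power of a b is 1 modulo N. *)
Lemma gring_red_unitE n N e (a : group_ring int gT) :
  (1 < n)%N -> (1 < N)%N -> (n %| N)%N -> (N %| n ^ e.+1)%N ->
  (gring_red 'Z_N a \is a GRing.unit) = (gring_red 'Z_n a \is a GRing.unit).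
Proof.
move=> n_gt1 N_gt1 nN Nn; apply/idP/idP => [aU|aU].
  pose b := gring_lift (gring_red 'Z_N a)^-1.
  have ab1 : gring_red 'Z_N (a * b) = gring_red 'Z_N 1.
    by rewrite rmorphM rmorph1 /= gring_liftK mulrV.
  have : gring_red 'Z_n (a * b) = 1.
    rewrite -(gring_red_lift_red _ n_gt1 N_gt1 nN) ab1.
    by rewrite gring_red_lift_red // rmorph1.
  by rewrite rmorphM => /gring_mul_eq1[].
pose b := gring_lift (gring_red 'Z_n a)^-1.
have ab1 : gring_red 'Z_n (a * b) = 1.
  by rewrite rmorphM /= gring_liftK mulrV.
have := gring_red_eq1_exp n_gt1 N_gt1 Nn ab1.
rewrite rmorphM => /gring_exp_eq1[] //.
by rewrite expn_gt0 ltnW.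
Qed.

Lemma card_gring_units n N e :
  (1 < n)%N -> (1 < N)%N -> (n %| N)%N -> (N %| n ^ e.+1)%N ->
  #|[set: {unit group_ring 'Z_N gT}]| =
    ((N %/ n) ^ #|gT| * #|[set: {unit group_ring 'Z_n gT}]|)%N.
Proof.
move=> n_gt1 N_gt1 nN Nn.
pose U M := [pred x : group_ring 'Z_M gT | x \is a GRing.unit].
have cardU M : #|[set: {unit group_ring 'Z_M gT}]| = #|U M|.
  by rewrite cardsT card_sub.
have cardG M : (1 < M)%N -> #|{: group_ring 'Z_M gT}| = (M ^ #|gT|)%N.
  by move=> M_gt1; rewrite card_ffun card_ord Zp_cast.
rewrite !cardU.
pose phi (x : group_ring 'Z_N gT) := gring_red 'Z_n (gring_lift x).
have phi_red a : phi (gring_red 'Z_N a) = gring_red 'Z_n a.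
  exact: gring_red_lift_red.
(* The lift is not additive, but phi is: represent x and y by reductions. *)
have phiD : {morph phi : x y / x + y}.
  move=> x y; rewrite -[in LHS](gring_liftK x) -[in LHS](gring_liftK y).
  by rewrite -rmorphD phi_red rmorphD.
have phi_surj y : exists x, phi x = y.
  by exists (gring_red 'Z_N (gring_lift y)); rewrite phi_red gring_liftK.
have := card_preim_additive (U n) phiD phi_surj.
have -> : #|[pred x | phi x \in U n]| = #|U N|.
  apply: eq_card => x; rewrite !inE -[in RHS](gring_liftK x).
  by rewrite (gring_red_unitE _ n_gt1 N_gt1 nN Nn).
have N_exp : (N ^ #|gT| = (N %/ n) ^ #|gT| * n ^ #|gT|)%N.
  by rewrite -expnMn divnK.
rewrite !cardG // N_exp mulnA => /eqP.
by rewrite eqn_pmul2r ?expn_gt0 ?(ltnW n_gt1) // mulnC => /eqP.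
Qed.

End Units.

(** * Combining the primes *)

Theorem theorem4p17 (gT : finGroupType) (abG : abelian [set: gT])
    (m : nat) (m_ge2 : (2 <= m)%N)
    (j : nat) (p r : 'I_j -> nat)
    (p_prime : forall i : 'I_j, prime (p i)) (p_inj : injective p)
    (r_ge1 : forall i : 'I_j, (1 <= r i)%N)
    (m_fact : m = (\prod_(i < j) p i ^ r i)%N) :
  let P := (\prod_(i < j) p i)%N in
  let k := (\max_(i < j) r i)%N in
  let c := fun i : 'I_j => (P %/ p i)%N in
  (forall (t : 'I_j -> nat) (f : 'I_j -> group_ring int gT),
     (forall i : 'I_j, t i * c i = 1 %[mod p i])%N ->
     (forall i : 'I_j, gring_red 'Z_(p i) (f i) \is a GRing.unit) ->
     let F : group_ring 'Z_m gT :=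
       gring_red 'Z_m (\sum_(i < j) f i *+ (t i * c i)) in
     F \is a GRing.unit /\
     (forall g : 'I_j -> group_ring int gT,
        (forall i : 'I_j,
           gring_red 'Z_(p i) (f i) * gring_red 'Z_(p i) (g i) = 1) ->
        F^-1 =
          gring_red 'Z_m (\sum_(i < j) g i *+ (t i * c i)) ^+ (P ^ (k - 1))
            * F ^+ (P ^ (k - 1) - 1)))
  /\ #|[set: {unit group_ring 'Z_m gT}]| =
       ((m %/ P) ^ #|gT| * #|[set: {unit group_ring 'Z_P gT}]|)%N.
Proof.
move=> P k c.
have [i0 _] : exists i : 'I_j, true.
  case: (posnP j) => [j0 | j_gt0]; last by exists (Ordinal j_gt0).
  move: m_ge2; rewrite m_fact big1 // => i.
  by have := ltn_ord i; rewrite [X in (_ < X)%N]j0.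
have p_gt1 i : (1 < p i)%N by exact: prime_gt1.
have p_dvdP i : (p i %| P)%N by rewrite /P (bigD1 i) //= dvdn_mulr.
have P_gt0 : (0 < P)%N by rewrite /P prodn_gt0 // => i; exact: ltnW.
have P_gt1 : (1 < P)%N by apply: leq_trans (p_gt1 i0) _; exact: dvdn_leq.
have r_le_k i : (r i <= k)%N by exact: leq_bigmax.
have k_eq : ((k - 1).+1 = k)%N by rewrite subn1 prednK // (leq_trans (r_ge1 i0)).
have Pm : (P %| m)%N.
  rewrite m_fact; apply: (big_ind2 dvdn) => // [*|i _]; first exact: dvdn_mul.
  exact: dvdn_exp.
have mP : (m %| P ^ (k - 1).+1)%N.
  rewrite k_eq m_fact /P.
  rewrite (big_morph (expn^~ k) (fun x y => expnMn x y k) (exp1n k)).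
  apply: (big_ind2 dvdn) => // [*|i _]; first exact: dvdn_mul.
  exact: dvdn_exp2l.
split; last exact: card_gring_units mP.
move=> t f tc1 f_unit F.
pose crt (h : 'I_j -> group_ring int gT) := \sum_(i < j) h i *+ (t i * c i).
have red_crt h i : gring_red 'Z_(p i) (crt h) = gring_red 'Z_(p i) (h i).
  rewrite rmorph_sum (bigD1 i) //= big1 ?addr0 => [|l l_i].
    have tc_gt0 : (0 < t i * c i)%N.
      move: (tc1 i); case: (t i * c i)%N => // /eqP.
      by rewrite mod0n modn_small.
    have p_dvd : (p i %| t i * c i - 1)%N by rewrite -eqn_mod_dvd // tc1.
    rewrite -[(t i * c i)%N](subnKC tc_gt0) mulrnDr mulr1n rmorphD /=.
    by rewrite gring_red_mulrn ?addr0.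
  rewrite gring_red_mulrn //; apply: dvdn_mull.
  rewrite /c /P (bigD1 l) //= mulKn ?prime_gt0 //.
  by rewrite (bigD1 i) 1?eq_sym //= dvdn_mulr.
have F_inv g :
    (forall i, gring_red 'Z_(p i) (f i) * gring_red 'Z_(p i) (g i) = 1) ->
    F \is a GRing.unit /\
    F^-1 = gring_red 'Z_m (crt g) ^+ (P ^ (k - 1)) * F ^+ (P ^ (k - 1) - 1).
  move=> fg1; apply: gring_exp_eq1 => //; first by rewrite expn_gt0 P_gt0.
  rewrite -rmorphM; apply: gring_red_eq1_exp mP _ => //.
  (* Coefficientwise, a congruence modulo P is one modulo every p_i. *)
  apply/eqP; rewrite -subr_eq0 -(rmorph1 (gring_red 'Z_P)) -rmorphB.
  apply/gring_red_eq0P => // x; apply: dvdn_prod_primes => // i.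
  apply/gring_red_eq0P: x => //.
  by rewrite rmorphB rmorphM /= !red_crt fg1 rmorph1 subrr.
split=> [|g /F_inv[]//].
apply: (F_inv (fun i => gring_lift (gring_red 'Z_(p i) (f i))^-1) _).1 => i.
by rewrite gring_liftK mulrV ?f_unit.
Qed.
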